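(* Let $G$ be an additive group of order $g$, let $q=\lambda n+1$ be a prime power, and let $\Sigma$ be a $(G,K,\lambda)$-SDF admitting a good lifting $\mathcal L$ to $G\times\mathbb F_q$. Then there exists a $(G\times\mathbb F_q,\,G\times\{0\},\,\underline{n}K,\,1)$-DF, and this DF is resolvable if $\Sigma$ is harmonious and $\mathcal L$ is perfect.
   Context: For a multiset $B=\{b_1,\dots,b_k\}$ in an additive group, $\Delta B=\{b_i-b_j\mid i\ne j\}$ (multiset); for a collection $\mathcal F$, $\Delta\mathcal F$ is the multiset union of the $\Delta B$ and the flatten of $\mathcal F$ is the multiset union of its members. A $(G,H,K,\lambda)$-DF is a collection $\mathcal F$ of multisets in $G$ ($H\le G$) with $\Delta\mathcal F$ equal to $\lambda$ copies of $G\setminus H$, $K$ being the multiset of block sizes; it is resolvable (when $\lambda=1$) if its flatten is a complete system of representatives of the non-trivial left cosets of $H$. A $(G,K,\lambda)$-SDF (strong difference family) is a collection $\Sigma$ of multisets in $G$ with multiset of sizes $K$ such that $\Delta\Sigma$ is $\lambda$ copies of all of $G$ (including $0$); it is harmonious if the sum of its block sizes equals $\lambda$. $\underline{n}K$ denotes the multiset union of $n$ copies of $K$. A lifting of $\Sigma$ to $G\times\mathbb F_q$ ($q\equiv1\pmod\lambda$) replaces each block $B=\{b_1,\dots,b_k\}$ by $\ell(B)=\{(b_1,c_1),\dots,(b_k,c_k)\}$ with $c_i\in\mathbb F_q$; with $\mathcal L=\{\ell(B)\mid B\in\Sigma\}$ one has $\Delta\mathcal L=\bigcup_{x\in G}\{x\}\times\Delta_x$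 where each $\Delta_x$ is a multiset of $\lambda$ elements of $\mathbb F_q$. A subset $S\subseteq\mathbb F_q$ of size $(q-1)/\lambda$ is a good companion for $\mathcal L$ if, for every $x\in G$, the multiset $S\cdot\Delta_x=\{sd\mid s\in S,d\in\Delta_x\}$ equals $\mathbb F_q^*$ (each element once); $\mathcal L$ is a good lifting if it has a good companion. If $\Sigma$ is harmonious, let $\pi(\mathcal L)$ be the multiset of second coordinates of all elements of all blocks of $\mathcal L$; a good companion $S$ with $S\cdot\pi(\mathcal L)=\mathbb F_q^*$ is a perfect companion, and $\mathcal L$ is then a perfect lifting. *)

(* Defs.v *)
From HB Require Import structures.
From mathcomp Require Import all_boot all_order all_fingroup all_algebra.

Set Implicit Arguments.
Unset Strict Implicit.
Unset Printing Implicit Defensive.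

Import GRing.Theory.

Local Open Scope group_scope.

(* Multisets are sequences up to [perm_eq].  The additive group G, which need
   not be abelian, is a [finGroupType] written multiplicatively: the difference
   b - b' is [b * b'^-1] and the left coset x + H is [x *: H].  On
   [gT * F] with F a finite field, [*], [^-1] and [1] are those of the direct
   product of gT with the additive group of F. *)

Definition copies (T : Type) (m : nat) (s : seq T) : seq T :=
  flatten (nseq m s).

Section DifferenceFamilies.

Variable gT : finGroupType.
Implicit Types (B : seq gT) (Fam Sigma : seq (seq gT)).

Definition block_diff B : seq gT :=
  [seq nth 1 B i * (nth 1 B j)^-1 |
     i <- iota 0 (size B), j <- [seq j <- iota 0 (size B) | j != i]].

Definition family_diff Fam : seq gT := flatten [seq block_diff B | B <- Fam].

Definition difference_family (H : {group gT}) (K : seq nat) (lambda : nat) Fam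
    : Prop :=
  perm_eq [seq size B | B <- Fam] K
  /\ perm_eq (family_diff Fam) (copies lambda (enum ([set: gT] :\: H))).

(* Each left coset other than H itself contains exactly one element of the
   flatten of the family, counted with multiplicity, and H contains none. *)
Definition resolvable (H : {group gT}) Fam : Prop :=
  perm_eq [seq x *: H | x <- flatten Fam]
          (enum (lcosets H [set: gT] :\ (H : {set gT}))).

Definition strong_difference_family (K : seq nat) (lambda : nat) Sigma : Prop :=
  perm_eq [seq size B | B <- Sigma] K
  /\ perm_eq (family_diff Sigma) (copies lambda (enum [set: gT])).

Definition harmonious (lambda : nat) Sigma : Prop :=
  sumn [seq size B | B <- Sigma] = lambda.

End DifferenceFamilies.

Section Liftings.

Variables (gT : finGroupType) (F : finFieldType).
Implicit Types (Sigma : seq (seq gT)) (L : seq (seq (gT * F))) (S : {set F}).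

Definition lifting Sigma L : Prop :=
  [seq [seq b.1 | b <- B] | B <- L] = Sigma.

Definition lift_diff L (x : gT) : seq F :=
  [seq d.2 | d <- family_diff L & d.1 == x].

Definition field_prods S (D : seq F) : seq F :=
  [seq (s * d)%R | s <- enum S, d <- D].

Definition good_companion (lambda : nat) L S : Prop :=
  #|S| = #|F|.-1 %/ lambda
  /\ forall x : gT, perm_eq (field_prods S (lift_diff L x)) (enum [set~ 0%R : F]).

Definition good_lifting (lambda : nat) Sigma L : Prop :=
  lifting Sigma L /\ exists S, good_companion lambda L S.

Definition lift_proj L : seq F := [seq b.2 | b <- flatten L].

Definition perfect_companion (lambda : nat) L S : Prop :=
  good_companion lambda L S
  /\ perm_eq (field_prods S (lift_proj L)) (enum [set~ 0%R : F]).

Definition perfect_lifting (lambda : nat) Sigma L : Prop :=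
  lifting Sigma L /\ exists S, perfect_companion lambda L S.

Lemma group_set_base : group_set (setX [set: gT] [set 0%R : F]).
Proof. exact: (group_setX [set: gT]%G (1%G : {group F})). Qed.

Definition base_subgroup : {group gT * F} := Group group_set_base.

End Liftings.

Arguments base_subgroup : clear implicits.

(* Main.v *)
Require Import Defs.
From mathcomp Require Import all_boot all_order all_fingroup all_algebra.

(** Multiply the field coordinates of the lifted blocks by the elements of a
    companion S.  Scaling by s is an endomorphism of G x F, so the differences
    of the new family with first coordinate x have second coordinates S . D_x,
    that is, each non-zero element of F once.  The coset of G x {0} containing
    (x, y) depends only on y, so for a perfect companion S the same argument
    with S . pi(L) gives resolvability. *)

Set Implicit Arguments.
Unset Strict Implicit.
Unset Printing Implicit Defensive.

Import GRing.Theory.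

Local Open Scope group_scope.

(** Differences are the only operation in [block_diff], so compatibility of [f] with [x * y^-1] is
    the natural form of the homomorphism property here. *)
Lemma block_diff_map (gT rT : finGroupType) (f : gT -> rT)
    (fD : {morph f : x y / x * y^-1 >-> x * y^-1}) (B : seq gT) :
  block_diff (map f B) = map f (block_diff B).
Proof.
(* This lets [f] preserve the default value of [nth], so [nth_f] needs no bound on the index. *)
have f1 : f 1 = 1 by have := fD 1 1; rewrite !mulgV.
have nth_f i : nth 1 (map f B) i = f (nth 1 B i).
  have [ltiB | leBi] := ltnP i (size B); first exact: nth_map.
  by rewrite !nth_default ?size_map.
rewrite /block_diff size_map map_flatten -map_comp.
congr flatten; apply: eq_map => i /=.
by rewrite -map_comp; apply: eq_map => j /=; rewrite !nth_f fD.
Qed.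

Lemma family_diff_map (gT rT : finGroupType) (f : gT -> rT)
    (fD : {morph f : x y / x * y^-1 >-> x * y^-1}) (Fam : seq (seq gT)) :
  family_diff (map (map f) Fam) = map f (family_diff Fam).
Proof.
rewrite /family_diff map_flatten -!map_comp; congr flatten.
by apply: eq_map => B /=; apply: block_diff_map.
Qed.

Lemma family_diff_flatten (gT : finGroupType) (Fams : seq (seq (seq gT))) :
  family_diff (flatten Fams) = flatten (map (@family_diff gT) Fams).
Proof.
by elim: Fams => //= Fam Fams IH; rewrite -IH /family_diff map_cat flatten_cat.
Qed.

Lemma perm_copies (T : eqType) (m : nat) (s t : seq T) :
  perm_eq s t -> perm_eq (copies m s) (copies m t).
Proof. by move=> st; elim: m => //= m IH; apply: perm_cat. Qed.

Section ScaledFamily.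

Variables (gT : finGroupType) (F : finFieldType).
Implicit Types (L : seq (seq (gT * F))) (S : {set F}).

Definition scale_snd (s : F) (b : gT * F) : gT * F := (b.1, (s * b.2)%R).

Definition scaled_family S L : seq (seq (gT * F)) :=
  flatten [seq map (map (scale_snd s)) L | s <- enum S].

Lemma scale_sndB (s : F) :
  {morph scale_snd s : x y / x * y^-1 >-> x * y^-1}.
(* The group law on [F] is addition, so the second coordinate is distributivity. *)
Proof. by move=> [x a] [y b]; congr (_, _); apply: mulrBr. Qed.

Lemma size_scaled_family S L :
  [seq size B | B <- scaled_family S L] = copies #|S| [seq size B | B <- L].
Proof.
rewrite /scaled_family /copies map_flatten cardE.
elim: (enum S) => //= s r ->; congr (_ ++ _).
by rewrite -map_comp; apply: eq_map => B /=; rewrite size_map.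
Qed.

Lemma family_diff_scaled S L :
  family_diff (scaled_family S L) =
  [seq scale_snd s d | s <- enum S, d <- family_diff L].
Proof.
rewrite family_diff_flatten -map_comp; congr flatten; apply: eq_map => s /=.
by rewrite family_diff_map //; apply: scale_sndB.
Qed.

(** Scaling fixes the first coordinate, so only differences of [L] lying over [x] can contribute to
    [(x, y)]. *)
Lemma count_scaled_diff S L (x : gT) (y : F) :
  count_mem (x, y) (family_diff (scaled_family S L)) =
  count_mem y (field_prods S (lift_diff L x)).
Proof.
rewrite family_diff_scaled /field_prods /lift_diff.
elim: (enum S) => //= s r IH; rewrite !count_cat IH; congr (_ + _)%N.
rewrite !count_map count_filter; apply: eq_count => d /=.
by rewrite xpair_eqE andbC.
Qed.

Lemma snd_flatten_scaled S L :
  [seq b.2 | b <- flatten (scaled_family S L)] = field_prods S (lift_proj L).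
Proof.
rewrite /scaled_family /field_prods /lift_proj.
elim: (enum S) => //= s r IH.
rewrite flatten_cat map_cat IH; congr (_ ++ _).
by rewrite -map_flatten -!map_comp; apply: eq_map.
Qed.

Lemma scaled_family_diff_perm (lambda : nat) S L :
  good_companion lambda L S ->
  perm_eq (family_diff (scaled_family S L))
          (enum ([set: gT * F] :\: base_subgroup gT F)).
Proof.
case=> _ SD; apply/allP => -[x y] _ /=.
(* Both counts become membership tests in duplicate-free lists, and both tests say that [y] is
   non-zero. *)
rewrite count_scaled_diff (seq.permP (SD x)) !count_uniq_mem ?enum_uniq //.
by rewrite !mem_enum !inE /= andbT.
Qed.

Lemma lcoset_base (b : gT * F) :
  b *: base_subgroup gT F = setX [set: gT] [set b.2].
Proof.
apply/setP => -[x y]; rewrite mem_lcoset !inE /=.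
by rewrite FinRing.zmodMgE FinRing.zmodVgE addrC subr_eq0.
Qed.

Lemma scaled_family_resolvable (lambda : nat) S L :
  perfect_companion lambda L S ->
  resolvable (base_subgroup gT F) (scaled_family S L).
Proof.
case=> _ Spi; rewrite /resolvable (eq_map lcoset_base).
(* The cosets are the fibers of the second projection; injectivity of [fiber] carries the
   enumeration of non-zero [y] to one of cosets without repetition. *)
pose fiber (y : F) := setX [set: gT] [set y].
have fiber_inj : injective fiber.
  move=> y z /setP/(_ (1, y)); rewrite !inE /= eqxx.
  by move/esym/eqP.
rewrite (map_comp fiber snd) snd_flatten_scaled.
apply: perm_trans (perm_map fiber Spi) _.
apply: uniq_perm; rewrite ?enum_uniq ?map_inj_uniq ?enum_uniq // => A.
rewrite mem_enum !inE; apply/mapP/andP => [[y] | [AnH /lcosetsP[[x y] _ defA]]].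
  rewrite mem_enum !inE => yn0 ->; split.
    (* The base subgroup is [fiber 0] by definition. *)
    by apply: contraNneq yn0 => /fiber_inj->.
  by apply/lcosetsP; exists (1, y); rewrite ?inE ?lcoset_base.
exists y; last by rewrite defA lcoset_base.
rewrite mem_enum !inE; apply: contraNneq AnH => y0.
by rewrite defA lcoset_base /= y0.
Qed.

(* Perfection is decidable, so one companion serves both parts of the
   theorem. *)
Lemma good_companion_perfect_if (lambda : nat) (Sigma : seq (seq gT)) L :
  good_lifting lambda Sigma L ->
  exists2 S, good_companion lambda L S &
    perfect_lifting lambda Sigma L -> perfect_companion lambda L S.
Proof.
case=> _ [S0 S0good].
pose perfect S :=
  [&& #|S| == #|F|.-1 %/ lambda,
      [forall x, perm_eq (field_prods S (lift_diff L x)) (enum [set~ 0%R])]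
    & perm_eq (field_prods S (lift_proj L)) (enum [set~ 0%R])].
have perfectP S : reflect (perfect_companion lambda L S) (perfect S).
  by apply: (iffP and3P) => [[/eqP ? /forallP ? ?] | [[/eqP ? /forallP ?] ?]].
have [S /perfectP Sperf | noS] := pickP perfect.
  by exists S; first case: Sperf.
by exists S0 => // -[_ [S /perfectP]]; rewrite noS.
Qed.

End ScaledFamily.

Local Close Scope group_scope.

Theorem theorem3p7 (gT : finGroupType) (F : finFieldType)
    (g q lambda n : nat) (K : seq nat)
    (Sigma : seq (seq gT)) (L : seq (seq (gT * F)))
    (hg : #|[set: gT]| = g) (hq : q = lambda * n + 1) (hF : #|F| = q)
    (hSigma : strong_difference_family K lambda Sigma)
    (hL : good_lifting lambda Sigma L) :
  exists Fam : seq (seq (gT * F)),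
    difference_family (base_subgroup gT F) (copies n K) 1 Fam
    /\ (harmonious lambda Sigma -> perfect_lifting lambda Sigma L ->
        resolvable (base_subgroup gT F) Fam).
Proof.
have [S Sgood Sperf] := good_companion_perfect_if hL.
exists (scaled_family S L); split; last first.
  by move=> _ /Sperf; apply: scaled_family_resolvable.
split; last by rewrite /copies /= cats0; apply: scaled_family_diff_perm Sgood.
(* If [lambda] were 0, then [F] would have one element. Positivity allows the division giving
   [#|S| = (q - 1) / lambda = n]. *)
have lambda_gt0 : (0 < lambda)%N.
  by have := card_finNzRing_gt1 F; rewrite hF hq; case: (lambda).
have -> : n = #|S|.
  by case: Sgood => -> _; rewrite hF hq addn1 mulKn.
rewrite size_scaled_family; apply: perm_copies.
(* Forgetting the field coordinates of [L] gives back [Sigma], so both have the same block sizes. *)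
case: hSigma => sizeSigma _; apply: perm_trans sizeSigma.
case: hL => <- _; rewrite -map_comp.
rewrite (@eq_map _ _ _ (size \o map fst)) // => B /=.
by rewrite size_map.
Qed.
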